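(* Let $0<q<1$ and let $n\ge 0$ be an integer. Let $b_1=(b^n_{ijk}(u,v))_{i+j+k=n}$ be the row vector of triangular Bernstein polynomials of degree $n$, $$b^n_{ijk}(u,v)=\frac{n!}{i!\,j!\,k!}u^iv^j(1-u-v)^{n-i-j},\qquad i,j,k\ge 0,\ i+j+k=n,$$ and let $b_2=(B^n_{ijk}(u,v))_{i+j+k=n}$ be the row vector of triangular $q$-Bernstein polynomials of degree $n$. Then: (i) all the entries of the matrix $A$ of change of bases such that $b_2=b_1A$ are nonnegative; and (ii) $\operatorname{cond}(b_1;f,(u,v))\le\operatorname{cond}(b_2;f,(u,v))$ for every nonzero $f\in\langle b_1\rangle$ (the linear span of $b_1$) and all $u,v\ge 0$ such that $u+v\le 1$.
   Context: For a real number $q>0$ and a natural number $r$, the $q$-integer is $[r]=1+q+\cdots+q^{r-1}$ (so $[r]=r$ if $q=1$, and $[0]=0$). The $q$-factorial is $[r]!=[r][r-1]\cdots[1]$ with $[0]!=1$. The $q$-binomial coefficient is $\genfrac{[}{]}{0pt}{}{i}{j}=\frac{[i]!}{[j]!\,[i-j]!}$ if $i\ge j\ge 0$, and $0$ otherwise. For integers $i,j,k\ge 0$ with $i+j+k=n$, the triangular $q$-Bernstein polynomial is $$B^n_{ijk}(u,v)=\genfrac{[}{]}{0pt}{}{n}{k}\binom{i+j}{i}u^iv^j\prod_{s=0}^{k-1}(1-q^su-q^sv),$$ where an empty product equals $1$. Both $b_1$ and $b_2$ are bases of the space of real polynomials in $u,v$ of total degree at most $n$. Relative condition number: given $\Omega\subset\mathbb{R}^s$,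 a basis $\phi=(\phi_0,\ldots,\phi_m)$ of a space of real functions on $\Omega$, a function $f=\sum_{l=0}^m c_l\phi_l$ and a point $x\in\Omega$, $$\operatorname{cond}(\phi;f,x)=\frac{\sum_{l=0}^m|c_l\phi_l(x)|}{\|f\|_\infty},$$ where $\|f\|_\infty=\sup_{y\in\Omega}|f(y)|$. Here $\Omega=\{(u,v)\in\mathbb{R}^2: u,v\ge 0,\ u+v\le 1\}$. *)

(* Defs.v *)
From mathcomp Require Import all_boot all_order all_algebra.
From mathcomp Require Import boolp classical_sets functions reals.

Set Implicit Arguments.
Unset Strict Implicit.
Unset Printing Implicit Defensive.

Import Order.TTheory GRing.Theory Num.Theory.

Local Open Scope classical_set_scope.
Local Open Scope ring_scope.

Section QCombinatorics.
Variables (R : realType) (q : R).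

Definition qint (r : nat) : R := \sum_(i < r) q ^+ i.

Definition qfact (r : nat) : R := \prod_(1 <= s < r.+1) qint s.

Definition qbinom (i j : nat) : R :=
  if (j <= i)%N then qfact i / (qfact j * qfact (i - j)) else 0.

End QCombinatorics.

(* A system of functions phi on T is a row vector with entries in T -> R.    *)
Section ConditionNumber.
Variables (R : realType) (T : Type).

Definition lincomb m (phi : 'rV[T -> R]_m) (c : 'rV[R]_m) : T -> R :=
  fun x => \sum_(l < m) c 0 l * phi 0 l x.

Definition lspan m (phi : 'rV[T -> R]_m) : set (T -> R) := range (lincomb phi).

(* The coordinates of f with respect to phi; they are unique when phi is
   linearly independent, and 0 is a junk value when f is not in the span. *)
Definition coords m (phi : 'rV[T -> R]_m) (f : T -> R) : 'rV[R]_m :=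
  xget 0 [set c | f = lincomb phi c].

Definition sup_norm (f : T -> R) : R := sup (range (fun y => `|f y|)).

Definition cond m (phi : 'rV[T -> R]_m) (f : T -> R) (x : T) : R :=
  (\sum_(l < m) `|coords phi f 0 l * phi 0 l x|) / sup_norm f.

(* A real matrix multiplies a row of functions through constant functions. *)
Definition change_of_basis m (phi psi : 'rV[T -> R]_m) (A : 'M[R]_m) : Prop :=
  psi = phi *m map_mx (fun a : R => cst a : T -> R) A.

End ConditionNumber.

Section TriangularBernstein.
Variable R : realType.

Definition simplex : set (R * R) :=
  [set x | [/\ 0 <= x.1, 0 <= x.2 & x.1 + x.2 <= 1]].

Definition triangle (n : nat) : {pred 'I_n.+1 * 'I_n.+1 * 'I_n.+1} :=
  [pred t : 'I_n.+1 * 'I_n.+1 * 'I_n.+1 | t.1.1 + t.1.2 + t.2 == n :> nat]%N.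
#[global] Arguments triangle : clear implicits.

Definition bernstein (n i j k : nat) (u v : R) : R :=
  n`!%:R / (i`!%:R * j`!%:R * k`!%:R)
  * u ^+ i * v ^+ j * (1 - u - v) ^+ (n - i - j).

Definition qbernstein (q : R) (n i j k : nat) (u v : R) : R :=
  qbinom q n k * 'C(i + j, i)%:R * u ^+ i * v ^+ j
  * \prod_(s < k) (1 - q ^+ s * u - q ^+ s * v).

(* The row vector of the restrictions to the simplex of the functions
   F i j k, over all i + j + k = n. *)
Definition triangular_row (n : nat) (F : nat -> nat -> nat -> R -> R -> R) :
    'rV[simplex -> R]_#|triangle n| :=
  \row_l let t := enum_val (A := triangle n) l in
    fun x : simplex => F t.1.1 t.1.2 t.2 (val x).1 (val x).2.

Definition bernstein_basis (n : nat) := triangular_row n (bernstein n).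

Definition qbernstein_basis (q : R) (n : nat) :=
  triangular_row n (qbernstein q n).

End TriangularBernstein.

Arguments simplex : clear implicits.

(* Main.v *)
(** A nonnegative change of basis can only increase the condition number, by
the triangle inequality.  Nonnegativity of [A] comes from expanding the factors
[1 - q^s (u + v) = (1 - u - v) + (1 - q^s) u + (1 - q^s) v], whose coefficients
are nonnegative.  Both families have the shape [u^i v^j g_k(u + v)] up to nonzero
constants, with [g_k(0) = 1]: restricted to the rays [(t a, t (1 - a))] they are
triangular in the order of vanishing, in [t] and then in [a], hence linearly
independent. *)
Require Import Defs.
From mathcomp Require Import all_boot all_order all_algebra.
From mathcomp Require Import boolp classical_sets functions reals.
From mathcomp Require Import ring lra zify.

Import Order.TTheory GRing.Theory Num.Theory.
Local Open Scope ring_scope.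

(** * Coordinates, changes of basis and condition numbers *)

Section LinearCombinations.
Context {R : realType} {T : Type} {m : nat}.
Implicit Types (phi psi : 'rV[T -> R]_m) (A : 'M[R]_m).

Lemma lincomb_inj phi :
  (forall c, (forall x, lincomb phi c x = 0) -> c = 0) -> injective (lincomb phi).
Proof.
move=> phi0 c d cd; apply/subr0_eq/phi0 => x.
rewrite /lincomb (eq_bigr (fun l => c 0 l * phi 0 l x - d 0 l * phi 0 l x)).
  by rewrite sumrB; apply/eqP; rewrite subr_eq0; apply/eqP/(congr1 (@^~ x) cd).
by move=> l _; rewrite !mxE mulrBl.
Qed.

Lemma coords_lincomb phi c : injective (lincomb phi) -> coords phi (lincomb phi c) = c.
Proof. by move=> inj; apply: xget_unique => // d /inj. Qed.

(** Trades the matrix product over the ring of functions [T -> R] for real coordinates, one column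
    at a time. *)
Lemma change_of_basisE phi psi A :
  change_of_basis phi psi A <-> forall l, psi 0 l = lincomb phi (col l A)^T.
Proof.
have E l : (phi *m map_mx (fun a : R => cst a : T -> R) A) 0 l =
    lincomb phi (col l A)^T.
  rewrite mxE fct_sumE; apply/funext => x; apply: eq_bigr => k _.
  by rewrite !mxE mulrC.
split=> [-> // | H]; apply/rowP => l; by rewrite H E.
Qed.

(** Coordinates are row vectors, hence the transpose; the identity is an exchange of two finite
    sums. *)
Lemma lincomb_change_of_basis {phi psi A} c : change_of_basis phi psi A ->
  lincomb psi c = lincomb phi (c *m A^T).
Proof.
move=> /change_of_basisE H; apply/funext => x; rewrite /lincomb.
under eq_bigr => l _ do rewrite H /lincomb mulr_sumr.
rewrite exchange_big; apply: eq_bigr => k _ /=.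
by rewrite mxE mulr_suml; apply: eq_bigr => l _; rewrite !mxE mulrA.
Qed.

Lemma change_of_basis_inj phi psi A B : injective (lincomb phi) ->
  change_of_basis phi psi A -> change_of_basis phi psi B -> A = B.
Proof.
move=> inj /change_of_basisE HA /change_of_basisE HB; apply/matrixP => i l.
have /inj/rowP/(_ i) : lincomb phi (col l A)^T = lincomb phi (col l B)^T.
  by rewrite -HA HB.
by rewrite !mxE.
Qed.

(** If [c *m A^T = 0], then [c] and 0 give the same combination of [psi], so [c = 0]; thus [A^T] is
    row-free. *)
Lemma change_of_basis_unitmx phi psi A : injective (lincomb psi) ->
  change_of_basis phi psi A -> A \in unitmx.
Proof.
move=> inj H; rewrite -unitmx_tr -row_free_unit.
apply: inj_row_free => c cA0; apply: inj.
by rewrite !(lincomb_change_of_basis _ H) cA0 mul0mx.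
Qed.

Lemma sup_norm_ge0 (f : T -> R) : 0 <= sup_norm f.
Proof.
rewrite /sup_norm; case: (pselect (has_sup (range (fun y => `|f y|)))) => H.
  have [[_ [y _ _]] _] := H.
  by apply: le_trans (normr_ge0 (f y)) _; apply: sup_upper_bound => //; exists y.
(* The supremum of an empty or unbounded set is 0 by default. *)
by rewrite sup_out.
Qed.

(** With [c = d *m A^T], the triangle inequality bounds [|c_k|] by the sum over [l] of
    [|d_l| * A k l]. Multiplied by [phi_k x] and summed over [k], these bounds give exactly the
    numerator for [psi], as [A] and [phi x] are nonnegative. *)
Lemma cond_change_of_basis_le {phi psi A} f x :
  injective (lincomb phi) -> injective (lincomb psi) ->
  change_of_basis phi psi A -> (forall i j, 0 <= A i j) ->
  (forall l, 0 <= phi 0 l x) -> lspan phi f -> cond phi f x <= cond psi f x.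
Proof.
move=> injphi injpsi H A0 phi0 [c _ <-].
have Au := change_of_basis_unitmx _ _ _ injpsi H.
pose d := c *m (invmx A)^T.
have cE : c = d *m A^T by rewrite -mulmxA -trmx_mul mulmxV // trmx1 mulmx1.
rewrite /cond ler_wpM2r ?invr_ge0 ?sup_norm_ge0 //.
rewrite [in X in _ <= X]cE -(lincomb_change_of_basis d H) !coords_lincomb //.
have psiE l : `|d 0 l * psi 0 l x| = \sum_k `|d 0 l| * A k l * phi 0 k x.
  move/change_of_basisE: H => ->; rewrite normrM [X in _ * X]ger0_norm.
    by rewrite /lincomb mulr_sumr; apply: eq_bigr => k _; rewrite !mxE mulrA.
  by apply: sumr_ge0 => k _; rewrite !mxE mulr_ge0.
under [leRHS]eq_bigr => l _ do rewrite psiE.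
rewrite exchange_big; apply: ler_sum => k _.
rewrite normrM (ger0_norm (phi0 k)) -mulr_suml ler_wpM2r // cE mxE.
apply: le_trans (ler_norm_sum _ _ _) _; apply: ler_sum => l _.
by rewrite normrM [A^T l k]mxE (ger0_norm (A0 k l)).
Qed.

End LinearCombinations.

(** * Linear independence by order of vanishing *)

Section LinearIndependence.
Context {R : realType}.

Lemma poly_eq0_unit_interval (p : {poly R}) :
  (forall t, 0 <= t <= 1 -> p.[t] = 0) -> p = 0.
Proof.
move=> p0; apply/eqP/negPn/negP => pn0.
(* The points [1/(i+1)] are [size p] distinct roots in the unit interval, too many for a nonzero
   [p]. *)
pose rs := [seq i.+1%:R^-1 : R | i <- iota 0 (size p)].
suff : (size rs < size p)%N by rewrite size_map size_iota ltnn.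
apply: max_poly_roots => //.
  apply/allP => _ /mapP[i _ ->]; apply/rootP/p0.
  by rewrite invr_ge0 ler0n invf_le1 ?ltr0n // ler1n.
by rewrite map_inj_uniq ?iota_uniq // => i j /invr_inj/eqP; rewrite eqr_nat => /eqP[].
Qed.

(** Evaluation at 0 isolates [c 0], all other terms being divisible by ['X]; cancelling ['X] leaves
    the same situation with [c] and [g] shifted by one. *)
Lemma shifted_polys_free N (g : nat -> {poly R}) (c : nat -> R) :
  (forall i, (g i).[0] != 0) -> \sum_(i < N) c i *: ('X^i * g i) = 0 ->
  forall i, (i < N)%N -> c i = 0.
Proof.
elim: N g c => [//|N IH] g c g0 /[!big_ord_recl]/= S0.
have SE : \sum_(i < N) c (bump 0 i) *: ('X^(bump 0 i) * g (bump 0 i)) =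
    'X * \sum_(i < N) c i.+1 *: ('X^i * g i.+1).
  rewrite mulr_sumr; apply: eq_bigr => i _.
  by rewrite /bump leq0n add1n exprS -mulrA scalerAr.
rewrite SE expr0 mul1r in S0.
have c0 : c 0%N = 0.
  move: (congr1 (fun p : {poly R} => p.[0]) S0).
  rewrite !hornerE => /eqP.
  by rewrite mulf_eq0 (negPf (g0 _)) orbF => /eqP.
move=> [//|i] iN; apply: (IH (fun i => g i.+1) (fun i => c i.+1)) => //.
by move/eqP: S0; rewrite c0 scale0r add0r mulf_eq0 polyX_eq0 => /eqP.
Qed.

(** Terms of equal degree [d l] share the factor [g (d l)]; once they are grouped, the sum is a
    polynomial in [t] to which [shifted_polys_free] applies. *)
Lemma graded_sum_eq0 (L : finType) (P : pred L) N (d : L -> nat) (c : L -> R)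
    (g : nat -> {poly R}) :
  (forall l, P l -> (d l < N)%N) -> (forall i, (g i).[0] != 0) ->
  (forall t, 0 <= t <= 1 -> \sum_(l | P l) c l * t ^+ d l * (g (d l)).[t] = 0) ->
  forall i, \sum_(l | P l && (d l == i)) c l = 0.
Proof.
move=> dN g0 S0 i; case: (ltnP i N) => [iN|Ni]; last first.
  rewrite big_pred0 // => l; apply/negbTE/andP => -[/dN + /eqP dl].
  by rewrite dl ltnNge Ni.
apply: (shifted_polys_free N g (fun i => \sum_(l | P l && (d l == i)) c l)) => //.
apply: poly_eq0_unit_interval => t /S0 St; rewrite -[RHS]St horner_sum.
have N0 : (0 < N)%N by apply: leq_trans iN.
(* [insubd] only casts [d l] to an ordinal: its default is never reached, since [d l < N] on [P]. *)
rewrite [RHS](partition_big (fun l => insubd (Ordinal N0) (d l)) predT) //=.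
apply: eq_bigr => j _; rewrite !hornerE /= !mulr_suml; apply: eq_big => [l|l].
  by case: (boolP (P l)) => //= Pl; rewrite -val_eqE /= val_insubd dN.
by case/andP => _ /eqP ->.
Qed.

(** [graded_sum_eq0] is used twice: along a ray in [s], to separate the values of [i + j], then in
    the direction [b] of the ray, to separate the values of [i]. *)
Lemma triangular_row_inj n (F : nat -> nat -> nat -> R -> R -> R)
    (a : nat -> nat -> nat -> R) (g : nat -> {poly R}) :
  (forall i j k, (i + j + k)%N = n -> a i j k != 0) ->
  (forall k, (g k).[0] != 0) ->
  (forall i j k u v, (i + j + k)%N = n ->
     F i j k u v = a i j k * u ^+ i * v ^+ j * (g k).[u + v]) ->
  injective (lincomb (triangular_row n F)).
Proof.
move=> a0 g0 FE; apply: lincomb_inj => c S0.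
pose t (l : 'I_#|triangle n|) := enum_val (A := triangle n) l.
pose i l : nat := (t l).1.1; pose j l : nat := (t l).1.2; pose k l : nat := (t l).2.
have ijk l : (i l + j l + k l)%N = n by apply/eqP; apply: (enum_valP l).
pose e l := c 0 l * a (i l) (j l) (k l).
have ray b : 0 <= b <= 1 -> forall m,
    \sum_(l | (i l + j l)%N == m) e l * b ^+ i l * (1 - b) ^+ j l = 0.
  case/andP=> b0 b1 m.
  (* At [(s * b, s * (1 - b))] the sum [u + v] is [s], and [k = n - (i + j)], so the factor [g k]
     depends only on the degree in [s]. *)
  apply: (graded_sum_eq0 _ predT n.+1 (fun l => (i l + j l)%N) _
    (fun m => g (n - m)%N)) => // [l _|s /andP[s0 s1]].
    by rewrite ltnS -(ijk l) leq_addr.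
  have xs : (s * b, s * (1 - b)) \in simplex R.
    by apply/mem_set; split=> /=; [nra|nra|lra].
  rewrite -[RHS](S0 (SigSub xs)); apply: eq_bigr => l _.
  rewrite mxE /= -/(t l) -/(i l) -/(j l) -/(k l) FE //.
  have -> : (n - (i l + j l))%N = k l by rewrite -(ijk l) addKn.
  have -> : s * b + s * (1 - b) = s by ring.
  by rewrite /e !exprMn exprD; ring.
apply/rowP => l; rewrite mxE.
suff /eqP : e l = 0 by rewrite mulf_eq0 (negPf (a0 _ _ _ (ijk l))) orbF => /eqP.
(* For fixed [i + j], the power [(1 - b) ^+ j] depends only on [i] and is 1 at [b = 0]. Fixing [i]
   too leaves the single index [l], because [i + j + k = n]. *)
have := graded_sum_eq0 _ (fun h => (i h + j h)%N == (i l + j l)%N) n.+1 i e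
  (fun p => (1 - 'X) ^+ (i l + j l - p)) _ _ _ (i l).
rewrite (big_pred1 l) => [->//|h]; last first.
- apply/andP/eqP => [[/eqP h1 /eqP h2]|->]; last by rewrite !eqxx.
  have h3 : k h = k l by have := ijk h; have := ijk l; lia.
  have h4 : j h = j l by lia.
  apply: enum_val_inj; apply/eqP/andP; split; last exact/eqP/val_inj.
  by apply/andP; split; apply/eqP/val_inj.
- move=> b hb; rewrite -[RHS](ray b hb (i l + j l)%N); apply: eq_bigr => h /eqP <-.
  by rewrite addKn !hornerE.
- by move=> p; rewrite !hornerE subr0 expr1n oner_neq0.
- by move=> h _; rewrite ltnS -(ijk h) -addnA leq_addr.
Qed.

End LinearIndependence.

(** * The two Bernstein bases and the sign of the matrix between them *)

Section BernsteinBases.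
Context {R : realType} {q : R}.
Hypotheses (q_gt0 : 0 < q) (q_lt1 : q < 1).

Lemma bernstein_coef_gt0 n i j k : 0 < n`!%:R / (i`!%:R * j`!%:R * k`!%:R) :> R.
Proof. by rewrite divr_gt0 ?mulr_gt0 ?ltr0n ?fact_gt0. Qed.

Lemma bernsteinE n i j k (u v : R) : (i + j + k)%N = n ->
  bernstein n i j k u v =
  n`!%:R / (i`!%:R * j`!%:R * k`!%:R) * u ^+ i * v ^+ j * (1 - u - v) ^+ k.
Proof. by move=> <-; rewrite /bernstein -subnDA addKn. Qed.

Lemma qfact_gt0 r : 0 < qfact q r.
Proof.
rewrite /qfact big_nat; apply: prodr_gt0 => -[//|s] _.
rewrite /qint big_ord_recl ltr_pwDl ?expr0 //.
by apply: sumr_ge0 => i _; rewrite exprn_ge0 // ltW.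
Qed.

Lemma qbinom_gt0 n k : (k <= n)%N -> 0 < qbinom q n k.
Proof. by move=> kn; rewrite /qbinom kn divr_gt0 ?mulr_gt0 ?qfact_gt0. Qed.

Lemma bernstein_basis_inj n : injective (lincomb (bernstein_basis R n)).
Proof.
apply: (triangular_row_inj n _ (fun i j k => n`!%:R / (i`!%:R * j`!%:R * k`!%:R))
  (fun k => (1 - 'X) ^+ k)) => [i j k _|k|i j k u v ijk].
- by rewrite gt_eqF ?bernstein_coef_gt0.
- by rewrite !hornerE subr0 expr1n oner_neq0.
- by rewrite bernsteinE // !hornerE opprD addrA.
Qed.

Lemma qbernstein_basis_inj n : injective (lincomb (qbernstein_basis q n)).
Proof.
apply: (triangular_row_inj n _ (fun i j k => qbinom q n k * 'C(i + j, i)%:R)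
  (fun k => \prod_(s < k) (1 - q ^+ s *: 'X))) => [i j k <-|k|i j k u v ijk].
- by rewrite gt_eqF // mulr_gt0 ?qbinom_gt0 ?leq_addl // ltr0n bin_gt0 leq_addr.
- rewrite horner_prod big1 ?oner_neq0 // => s _.
  by rewrite !hornerE /= subr0.
- rewrite /qbernstein horner_prod; congr (_ * _); apply: eq_bigr => s _.
  by rewrite !hornerE /=; ring.
Qed.

Lemma bernstein_basis_ge0 n l (x : simplex R) : 0 <= bernstein_basis R n 0 l x.
Proof.
case: x => x xs; have /set_mem[x1 x2 x3] := xs.
rewrite mxE /bernstein /= !mulr_ge0 ?exprn_ge0 // ?invr_ge0 ?mulr_ge0 //.
by rewrite -addrA -opprD subr_ge0.
Qed.

(** Membership of a q-Bernstein polynomial expresses that its column of [A] is nonnegative. Taking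
    [f] on the whole plane lets polynomial identities be applied before restriction to the
    simplex. *)
Definition bernstein_cone n (f : R -> R -> R) :=
  exists2 c : 'rV[R]_#|triangle n|, (forall l, 0 <= c 0 l) &
    (fun x : simplex R => f (val x).1 (val x).2) = lincomb (bernstein_basis R n) c.

Lemma bernstein_cone_add n f g : bernstein_cone n f -> bernstein_cone n g ->
  bernstein_cone n (fun u v => f u v + g u v).
Proof.
move=> [c c0 cE] [d d0 dE]; exists (c + d) => [l|]; first by rewrite mxE addr_ge0.
apply/funext => x; rewrite (congr1 (@^~ x) cE) (congr1 (@^~ x) dE) /lincomb.
by rewrite -big_split; apply: eq_bigr => l _; rewrite [in RHS]mxE mulrDl.
Qed.

Lemma bernstein_cone_scale n a f : 0 <= a -> bernstein_cone n f ->
  bernstein_cone n (fun u v => a * f u v).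
Proof.
move=> a0 [c c0 cE]; exists (a *: c) => [l|]; first by rewrite mxE mulr_ge0.
apply/funext => x; rewrite (congr1 (@^~ x) cE) /lincomb mulr_sumr.
by apply: eq_bigr => l _; rewrite [in RHS]mxE mulrA.
Qed.

Lemma bernstein_cone_monomial n i j k : (i + j + k)%N = n ->
  bernstein_cone n (fun u v => u ^+ i * v ^+ j * (1 - u - v) ^+ k).
Proof.
move=> ijk; have [i_lt j_lt k_lt] : [/\ (i < n.+1)%N, (j < n.+1)%N & (k < n.+1)%N].
  by split; lia.
pose t := (Ordinal i_lt, Ordinal j_lt, Ordinal k_lt).
have tn : t \in triangle n by rewrite inE /= ijk.
have [C C0 CE] : exists2 C : R, 0 < C & forall u v,
    bernstein n i j k u v = C * (u ^+ i * v ^+ j * (1 - u - v) ^+ k).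
  exists (n`!%:R / (i`!%:R * j`!%:R * k`!%:R)) => [|u v].
    exact: bernstein_coef_gt0.
  by rewrite bernsteinE // !mulrA.
pose l0 := enum_rank_in tn t.
(* The monomial is [C^-1] times the basis function of index [(i, j, k)]. *)
exists (\row_l if l == l0 then C^-1 else 0) => [l|].
  by rewrite mxE; case: ifP => // _; rewrite invr_ge0 ltW.
apply/funext => x; rewrite /lincomb (bigD1 l0) //= big1 => [|l /negPf ll0].
  by rewrite !mxE eqxx enum_rankK_in //= CE addr0 mulKf // gt_eqF.
by rewrite mxE ll0 mul0r.
Qed.

(** The power of [1 - u - v] makes the induction on [m] go through: the last factor of the product
    is [(1 - u - v) + (1 - q ^+ m) * u + (1 - q ^+ m) * v], and each summand raises one of the
    exponents [k], [i], [j] by one. *)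
Lemma bernstein_cone_qprod n i j k m : (i + j + k + m)%N = n ->
  bernstein_cone n (fun u v => u ^+ i * v ^+ j * (1 - u - v) ^+ k *
    \prod_(s < m) (1 - q ^+ s * u - q ^+ s * v)).
Proof.
elim: m i j k => [|m IH] i j k ijkm.
  have -> : (fun u v : R => u ^+ i * v ^+ j * (1 - u - v) ^+ k *
      \prod_(s < 0) (1 - q ^+ s * u - q ^+ s * v)) =
      fun u v => u ^+ i * v ^+ j * (1 - u - v) ^+ k.
    by apply/funext => u; apply/funext => v; rewrite big_ord0 mulr1.
  by apply: bernstein_cone_monomial; rewrite -ijkm addn0.
have qm : 0 <= 1 - q ^+ m by rewrite subr_ge0 exprn_ile1 // ltW.
have H1 := IH i j k.+1 ltac:(lia).
have H2 := bernstein_cone_scale _ _ _ qm (IH i.+1 j k ltac:(lia)).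
have H3 := bernstein_cone_scale _ _ _ qm (IH i j.+1 k ltac:(lia)).
have := bernstein_cone_add _ _ _ H1 (bernstein_cone_add _ _ _ H2 H3).
congr (bernstein_cone n _); apply/funext => u; apply/funext => v.
by rewrite big_ord_recr /= !exprS; ring.
Qed.

Lemma qbernstein_cone n i j k : (i + j + k)%N = n ->
  bernstein_cone n (qbernstein q n i j k).
Proof.
move=> ijk; have a0 : 0 <= qbinom q n k * 'C(i + j, i)%:R.
  by rewrite mulr_ge0 // ltW // qbinom_gt0 // -ijk leq_addl.
have := bernstein_cone_scale _ _ _ a0 (bernstein_cone_qprod n i j 0 k ltac:(lia)).
congr (bernstein_cone n _); apply/funext => u; apply/funext => v.
by rewrite /qbernstein expr0 mulr1 !mulrA.
Qed.

Lemma qbernstein_change_of_basis n : exists2 A : 'M[R]_#|triangle n|,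
  change_of_basis (bernstein_basis R n) (qbernstein_basis q n) A &
  forall i j, 0 <= A i j.
Proof.
have /choice[c cP] l : exists c : 'rV[R]_#|triangle n|, (forall k, 0 <= c 0 k) /\
    qbernstein_basis q n 0 l = lincomb (bernstein_basis R n) c.
  have /eqP/qbernstein_cone[c c0 cE] := enum_valP l.
  by exists c; split=> //; rewrite -cE mxE.
(* The coordinates chosen for the [l]-th q-Bernstein polynomial form column [l]. *)
exists (\matrix_(i, l) c l 0 i) => [|i l]; last by rewrite mxE; have [] := cP l.
apply/change_of_basisE => l; have [_ ->] := cP l; congr lincomb.
by apply/rowP => k; rewrite !mxE.
Qed.

End BernsteinBases.

Theorem theorem6p3 (R : realType) (q : R) (n : nat) (hq0 : 0 < q) (hq1 : q < 1) :
  let b1 := bernstein_basis R n in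
  let b2 := qbernstein_basis q n in
  (exists2 A : 'M[R]_#|triangle n|,
     unique (change_of_basis b1 b2) A & forall i j, 0 <= A i j) /\
  (forall f : simplex R -> R, lspan b1 f -> f <> 0 ->
     forall x : simplex R, cond b1 f x <= cond b2 f x).
Proof.
move=> b1 b2; have [A bA A0] := qbernstein_change_of_basis hq0 hq1 n.
have inj1 : injective (lincomb b1) := bernstein_basis_inj n.
(* Uniqueness of [A] comes from the linear independence of [b1]. *)
split; first by exists A => //; split=> // B; apply: change_of_basis_inj.
move=> f f_span _ x; apply: cond_change_of_basis_le bA A0 _ f_span => //.
  exact: qbernstein_basis_inj.
by move=> l; apply: bernstein_basis_ge0.
Qed.
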